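(* Let $f$ be a slice regular function on $B=B(0,R)=\{q\in\mathbb{H}:|q|<R\}$, $R>0$, and let $f^c$ be its regular conjugate. Then $$\sup_{q\in B}|f(q)|=\sup_{q\in B}|f^c(q)|\quad\text{and}\quad \inf_{q\in B}|f(q)|=\inf_{q\in B}|f^c(q)|.$$
   Context: $\mathbb{H}$ is the skew field of quaternions; $\mathbb{S}=\{q\in\mathbb{H}:q^2=-1\}$; for $I\in\mathbb{S}$, $L_I=\mathbb{R}+\mathbb{R}I$ and $B_I=B(0,R)\cap L_I$. A function $f:B(0,R)\to\mathbb{H}$ is slice regular if for every $I\in\mathbb{S}$ its restriction $f_I$ to $B_I$ has continuous partial derivatives and satisfies $\frac12\left(\frac{\partial}{\partial x}+I\frac{\partial}{\partial y}\right)f_I(x+yI)=0$ on $B_I$; equivalently, $f(q)=\sum_{n\ge0}q^na_n$ is a convergent power series on $B(0,R)$ with $a_n\in\mathbb{H}$. The regular conjugate of $f(q)=\sum_{n\ge0}q^na_n$ is $f^c(q)=\sum_{n\ge0}q^n\overline{a_n}$. Suprema may equal $+\infty$. *)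

(* Defs.v *)
From Stdlib Require Import Reals Lra Psatz ClassicalEpsilon.
From Coquelicot Require Import Coquelicot.
Open Scope R_scope.

Record quat : Type := Quat { qre : R; qi : R; qj : R; qk : R }.

Definition qplus (p q : quat) : quat :=
  Quat (qre p + qre q) (qi p + qi q) (qj p + qj q) (qk p + qk q).

Definition qopp (q : quat) : quat := Quat (- qre q) (- qi q) (- qj q) (- qk q).

Definition qreal (x : R) : quat := Quat x 0 0 0.

Definition qmult (p q : quat) : quat :=
  Quat (qre p * qre q - qi p * qi q - qj p * qj q - qk p * qk q)
       (qre p * qi q + qi p * qre q + qj p * qk q - qk p * qj q)
       (qre p * qj q - qi p * qk q + qj p * qre q + qk p * qi q)
       (qre p * qk q + qi p * qj q - qj p * qi q + qk p * qre q).

Definition qconj (q : quat) : quat := Quat (qre q) (- qi q) (- qj q) (- qk q).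

Definition qnorm (q : quat) : R :=
  sqrt (qre q ^ 2 + qi q ^ 2 + qj q ^ 2 + qk q ^ 2).

Definition qscal (x : R) (q : quat) : quat :=
  Quat (x * qre q) (x * qi q) (x * qj q) (x * qk q).

Local Ltac quat_ring :=
  intros; repeat match goal with q : quat |- _ => destruct q end;
  unfold qplus, qopp, qmult, qscal, qreal; simpl; f_equal; ring.

Definition quat_AbelianMonoid_mixin : AbelianMonoid.mixin_of quat.
Proof.
apply (AbelianMonoid.Mixin quat qplus (qreal 0)); quat_ring.
Defined.

Canonical quat_AbelianMonoid :=
  AbelianMonoid.Pack quat quat_AbelianMonoid_mixin quat.

Definition quat_AbelianGroup_mixin : AbelianGroup.mixin_of quat_AbelianMonoid.
Proof.
apply (AbelianGroup.Mixin quat_AbelianMonoid qopp).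
change (forall q : quat, qplus q (qopp q) = qreal 0); quat_ring.
Defined.

Canonical quat_AbelianGroup :=
  AbelianGroup.Pack quat
    (AbelianGroup.Class _ quat_AbelianMonoid_mixin quat_AbelianGroup_mixin) quat.

Definition quat_Ring_mixin : Ring.mixin_of quat_AbelianGroup.
Proof.
apply (Ring.Mixin quat_AbelianGroup qmult (qreal 1));
  unfold plus; simpl; quat_ring.
Defined.

Canonical quat_Ring :=
  Ring.Pack quat (Ring.Class _ _ quat_Ring_mixin) quat.

Lemma qnorm_sq (q : quat) :
  qnorm q ^ 2 = qre q ^ 2 + qi q ^ 2 + qj q ^ 2 + qk q ^ 2.
Proof. unfold qnorm; rewrite pow2_sqrt; nra. Qed.

Lemma qnorm_ge0 (q : quat) : 0 <= qnorm q.
Proof. apply sqrt_pos. Qed.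

Lemma qnorm_eq0 (q : quat) : qnorm q = 0 -> q = qreal 0.
Proof.
intros H; assert (E := qnorm_sq q); rewrite H in E.
destruct q as [a b c d]; simpl in *.
unfold qreal; f_equal; nra.
Qed.

Lemma qnorm_mult (p q : quat) : qnorm (qmult p q) = qnorm p * qnorm q.
Proof.
unfold qnorm; rewrite <- sqrt_mult by nra.
f_equal; unfold qmult; simpl; ring.
Qed.

Lemma qnorm_scal (x : R) (q : quat) : qnorm (qscal x q) = Rabs x * qnorm q.
Proof.
rewrite <- sqrt_Rsqr_abs; unfold qnorm, Rsqr; rewrite <- sqrt_mult by nra.
f_equal; unfold qscal; simpl; ring.
Qed.

Lemma qnorm_triangle (p q : quat) : qnorm (qplus p q) <= qnorm p + qnorm q.
Proof.
assert (Hp := qnorm_ge0 p); assert (Hq := qnorm_ge0 q).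
apply Rsqr_incr_0_var; [|lra].
rewrite !Rsqr_pow2.
replace ((qnorm p + qnorm q) ^ 2)
  with (qnorm p ^ 2 + qnorm q ^ 2 + 2 * (qnorm p * qnorm q)) by ring.
assert (CS : qre p * qre q + qi p * qi q + qj p * qj q + qk p * qk q
             <= qnorm p * qnorm q).
{ rewrite <- qnorm_mult.
  apply Rsqr_incr_0_var; [|apply qnorm_ge0].
  rewrite !Rsqr_pow2, qnorm_sq.
  destruct p as [a b c d], q as [a' b' c' d']; simpl.
  assert (H1 := pow2_ge_0 (a * b' - b * a')).
  assert (H2 := pow2_ge_0 (a * c' - c * a')).
  assert (H3 := pow2_ge_0 (a * d' - d * a')).
  assert (H4 := pow2_ge_0 (b * c' - c * b')).
  assert (H5 := pow2_ge_0 (b * d' - d * b')).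
  assert (H6 := pow2_ge_0 (c * d' - d * c')).
  lra. }
rewrite !qnorm_sq; destruct p, q; simpl in *; lra.
Qed.

Definition quat_AbsRing_mixin : AbsRing.mixin_of quat_Ring.
Proof.
apply (AbsRing.Mixin quat_Ring qnorm).
- change (qnorm (qreal 0) = 0); unfold qnorm; simpl.
  transitivity (sqrt 0); [f_equal; ring | exact sqrt_0].
- change (qnorm (qopp (qreal 1)) = 1); unfold qnorm; simpl.
  transitivity (sqrt 1); [f_equal; ring | exact sqrt_1].
- exact qnorm_triangle.
- intros p q; apply Req_le; exact (qnorm_mult p q).
- exact qnorm_eq0.
Defined.

Canonical quat_AbsRing :=
  AbsRing.Pack quat (AbsRing.Class _ _ quat_AbsRing_mixin) quat.

Canonical quat_UniformSpace :=
  UniformSpace.Pack quat (AbsRing_UniformSpace_mixin quat_AbsRing) quat.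

(* As for Coquelicot's C, there are two module structures on quat: the
   canonical one below is over R, while AbsRing_NormedModule quat_AbsRing is
   quat as a left module over itself.  They share norm and topology. *)
Definition quat_R_ModuleSpace_mixin :
  ModuleSpace.mixin_of R_Ring quat_AbelianGroup.
Proof.
apply (ModuleSpace.Mixin R_Ring quat_AbelianGroup qscal);
  unfold plus, mult, one; simpl; quat_ring.
Defined.

Canonical quat_R_ModuleSpace :=
  ModuleSpace.Pack R_Ring quat
    (ModuleSpace.Class R_Ring quat _ quat_R_ModuleSpace_mixin) quat.

Canonical quat_R_NormedModuleAux :=
  NormedModuleAux.Pack R_AbsRing quat
    (NormedModuleAux.Class R_AbsRing quat
       (ModuleSpace.class R_Ring quat_R_ModuleSpace)
       (UniformSpace.class quat_UniformSpace)) quat.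

Definition quat_R_NormedModule_mixin :
  NormedModule.mixin_of R_AbsRing quat_R_NormedModuleAux.
Proof.
apply (NormedModule.Mixin R_AbsRing quat_R_NormedModuleAux qnorm 1).
- exact qnorm_triangle.
- intros x q; apply Req_le; exact (qnorm_scal x q).
- intros p q e H; exact H.
- intros p q e H; rewrite Rmult_1_l; exact H.
- exact qnorm_eq0.
Defined.

Canonical quat_R_NormedModule :=
  NormedModule.Pack R_AbsRing quat
    (NormedModule.Class R_AbsRing quat _ quat_R_NormedModule_mixin) quat.

Definition imaginary_unit (I : quat) : Prop := qmult I I = qopp (qreal 1).

Definition in_ball (r : R) (q : quat) : Prop := qnorm q < r.

(* The point x + y I of the slice L_I. *)
Definition slice_point (I : quat) (x y : R) : quat :=
  qplus (qreal x) (qmult (qreal y) I).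

(* Functions on B(0,r) are represented by functions on quat whose values
   outside the ball are never used: each B_I is open in L_I, so derivability
   and continuity at a point of B_I only depend on the values on B_I. *)
Definition slice_regular (r : R) (f : quat -> quat) : Prop :=
  forall I : quat, imaginary_unit I ->
  exists fx fy : R -> R -> quat,
  forall x y : R, in_ball r (slice_point I x y) ->
    is_derive (fun t : R => f (slice_point I t y)) x (fx x y) /\
    is_derive (fun t : R => f (slice_point I x t)) y (fy x y) /\
    continuous (fun z : R * R => fx (fst z) (snd z)) (x, y) /\
    continuous (fun z : R * R => fy (fst z) (snd z)) (x, y) /\
    qscal (/ 2) (qplus (fx x y) (qmult I (fy x y))) = qreal 0.

(* The sum of the q^n a_n is l, with the coefficients on the right. *)
Definition is_qseries (a : nat -> quat) (q l : quat) : Prop :=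
  is_pseries (K := quat_AbsRing) (V := AbsRing_NormedModule quat_AbsRing) a q l.

(* The coefficients of the power series expansion of f on B(0,r).  A slice
   regular function has exactly one such sequence; the choice operator is
   arbitrary only for functions that have no expansion. *)
Definition regular_coeff (r : R) (f : quat -> quat) : nat -> quat :=
  epsilon (inhabits (fun _ : nat => qreal 0))
    (fun a => forall q : quat, in_ball r q -> is_qseries a q (f q)).

(* Limits in quat are unique, so this is the sum of the series whenever it
   converges. *)
Definition qseries (a : nat -> quat) (q : quat) : quat :=
  epsilon (inhabits (qreal 0)) (is_qseries a q).

Definition regular_conj (r : R) (f : quat -> quat) : quat -> quat :=
  qseries (fun n => qconj (regular_coeff r f n)).

Definition sup_ball (r : R) (g : quat -> quat) : Rbar :=
  Lub_Rbar (fun s : R => exists q : quat, in_ball r q /\ s = qnorm (g q)).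

Definition inf_ball (r : R) (g : quat -> quat) : Rbar :=
  Glb_Rbar (fun s : R => exists q : quat, in_ball r q /\ s = qnorm (g q)).

(* Main.v *)
(* A slice regular function is a power series: on each slice [L_I] its pairings
   with real functionals are real parts of holomorphic functions, to which
   Cauchy's formula applies, and the coefficients found on different slices
   agree because the slices share the real axis.  As [(x + y J)^n] is affine in
   [J], one gets [f (x + y J) = b + J c] and [f^c (x + y J) = conj b + J conj c]
   with [b], [c] independent of [J].  Up to a reflection of [J] the norms of
   these two values agree, so [|f|] and [|f^c|] have the same range on each
   sphere [x + y S], hence on the ball. *)

(* The restriction of [f] to a slice takes values in all of the quaternions, not in the slice, so it
   is not itself a complex function. For each [p] the real function [Re (p f)] has the harmonic
   conjugate [Re (- p I f)], and this pair carries the complex analysis. Only real integrals occur: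
   [dz / (i z)] on a circle is [ds], so Cauchy's formula becomes an integral over [[0, 2 pi]]
   against the kernel [z / (z - w)]. It is proved by shrinking the circle linearly to [w] and
   checking that the integral does not change. The norms of [f] and [f^c] at the same point may
   differ, because [c conj b] and [conj c b] can have different imaginary parts; their equal lengths
   are what allows moving to another point of the same sphere. *)
Require Import Defs.
From Stdlib Require Import Reals Lra ClassicalEpsilon.
From Coquelicot Require Import Coquelicot.
Open Scope R_scope.

(* Coquelicot lemmas leave equalities in the carrier of a structure over [R],
   which [ring] and [field] do not recognize as [R]. *)
Local Ltac real_eq := match goal with |- @eq _ ?x ?y => change (@eq R x y) end.

(** * Cauchy's formula and power series expansion of holomorphic pairs *)

(* [u + i v] is holomorphic on the open disc of radius [r], with continuous
   derivative [u' + i v']. *)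
Definition holomorphic_pair (r : R) (u v u' v' : R -> R -> R) : Prop :=
  forall x y : R, Cmod (x, y) < r ->
    is_derive (fun t => u t y) x (u' x y) /\
    is_derive (fun t => u x t) y (- v' x y) /\
    is_derive (fun t => v t y) x (v' x y) /\
    is_derive (fun t => v x t) y (u' x y) /\
    continuous (fun z : R * R => u' (fst z) (snd z)) (x, y) /\
    continuous (fun z : R * R => v' (fst z) (snd z)) (x, y).

(* Multiplication by [- i]: statements about [u] transfer to [v]. *)
Lemma holomorphic_pair_rotate (r : R) (u v u' v' : R -> R -> R) :
  holomorphic_pair r u v u' v' ->
  holomorphic_pair r v (fun x y => - u x y) v' (fun x y => - u' x y).
Proof.
intros H x y Hxy.
destruct (H x y Hxy) as (H1 & H2 & H3 & H4 & H5 & H6).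
refine (conj H3 (conj _ (conj _ (conj _ (conj H6 _))))); cbv beta.
- rewrite Ropp_involutive; exact H4.
- exact (is_derive_opp _ _ _ H1).
- rewrite <- (Ropp_involutive (v' x y)); exact (is_derive_opp _ _ _ H2).
- exact (continuous_opp _ _ H5).
Qed.

Lemma continuous_square (t : R) : continuous (fun s : R => s ^ 2) t.
Proof.
apply (ex_derive_continuous (V := R_NormedModule)); auto_derive; exact Logic.I.
Qed.

Lemma continuous_Cmod (x y : R) :
  continuous (fun z : R * R => Cmod (fst z, snd z)) (x, y).
Proof.
exact (continuous_comp (fun z : R * R => fst z ^ 2 + snd z ^ 2) sqrt (x, y)
  (continuous_plus (V := R_NormedModule) _ _ _
    (continuous_comp fst (fun s => s ^ 2) (x, y) (continuous_fst _ _) (continuous_square x))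
    (continuous_comp snd (fun s => s ^ 2) (x, y) (continuous_snd _ _) (continuous_square y)))
  (continuous_sqrt _)).
Qed.

Lemma locally_disc (r x y : R) :
  Cmod (x, y) < r -> locally (x, y) (fun z : R * R => Cmod (fst z, snd z) < r).
Proof.
intros H; apply (continuous_Cmod x y (fun s => s < r)).
exact (open_lt r _ H).
Qed.

(** Total differentiability follows from the [x]-partial existing near the point (the disc is open)
    and being continuous there, together with the [y]-partial at the point. *)
Lemma filterdiff_holomorphic (r : R) (u v u' v' : R -> R -> R) (x y : R) :
  holomorphic_pair r u v u' v' -> Cmod (x, y) < r ->
  filterdiff (fun z : R * R => u (fst z) (snd z)) (locally (x, y))
    (fun z => plus (scal (fst z) (u' x y)) (scal (snd z) (- v' x y))).
Proof.
intros H Hxy.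
destruct (H _ _ Hxy) as (_ & H2 & _ & _ & H5 & _).
apply is_derive_filterdiff; auto.
generalize (locally_disc r _ _ Hxy); apply filter_imp.
intros [a b] Hab; apply (H a b Hab).
Qed.

Lemma is_derive_along_curve (r : R) (u v u' v' : R -> R -> R)
    (X Y : R -> R) (s X' Y' : R) :
  holomorphic_pair r u v u' v' -> Cmod (X s, Y s) < r ->
  is_derive X s X' -> is_derive Y s Y' ->
  is_derive (fun t => u (X t) (Y t)) s
    (u' (X s) (Y s) * X' - v' (X s) (Y s) * Y').
Proof.
intros H Hs HX HY.
eapply filterdiff_ext_lin.
- exact (filterdiff_comp'_2 X Y u s _ _
    (fun a b => plus (scal a (u' (X s) (Y s))) (scal b (- v' (X s) (Y s))))
    HX HY (filterdiff_holomorphic _ _ _ _ _ _ _ H Hs)).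
- intros t; unfold plus, scal; simpl; unfold mult; simpl; ring.
Qed.

Lemma continuous_holomorphic (r : R) (u v u' v' : R -> R -> R) (x y : R) :
  holomorphic_pair r u v u' v' -> Cmod (x, y) < r ->
  continuous (fun z : R * R => u (fst z) (snd z)) (x, y).
Proof.
intros H Hxy.
exact (filterdiff_continuous _ _
  (ex_intro _ _ (filterdiff_holomorphic _ _ _ _ _ _ _ H Hxy))).
Qed.

Section Cauchy.

Variables (r rho a b : R) (k1 k2 : R -> R).
Hypotheses (rho_pos : 0 < rho) (rho_lt : rho < r) (ab_lt : Cmod (a, b) < rho).
Hypotheses (k1_cont : forall s, continuous k1 s)
           (k2_cont : forall s, continuous k2 s).
(* [k1 + i k2] is the Cauchy kernel [z / (z - (a + i b))], [z = rho e^(i s)]. *)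
Hypotheses
  (k_re : forall s, (rho * cos s - a) * k1 s - (rho * sin s - b) * k2 s = rho * cos s)
  (k_im : forall s, (rho * cos s - a) * k2 s + (rho * sin s - b) * k1 s = rho * sin s).

(** [z_t = X t s + i Y t s] runs along the segment from [w = a + i b] at [t = 0] to the circle point
    [z = rho e^(i s)] at [t = 1]. *)
Let X (t s : R) := a + t * (rho * cos s - a).
Let Y (t s : R) := b + t * (rho * sin s - b).

Lemma Cmod_polar (t : R) : Cmod (rho * cos t, rho * sin t) = rho.
Proof.
unfold Cmod; simpl.
replace (_ + _) with (Rsqr rho * (Rsqr (sin t) + Rsqr (cos t)))
  by (unfold Rsqr; ring).
rewrite sin2_cos2, Rmult_1_r; apply sqrt_Rsqr; lra.
Qed.

(** [z_t = (1 - t) w + t z]. The absolute values keep the bound valid for [t] slightly outside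
    [[0, 1]], as differentiation at the endpoints requires; the bound does not involve [s], which
    makes the next lemma uniform in [s]. *)
Lemma homotopy_bound (t s : R) :
  Cmod (X t s, Y t s) <= Rabs (1 - t) * Cmod (a, b) + Rabs t * rho.
Proof.
replace (X t s, Y t s)
  with (RtoC (1 - t) * (a, b) + RtoC t * (rho * cos s, rho * sin s)%R)%C.
- eapply Rle_trans; [apply Cmod_triangle|].
  rewrite !Cmod_mult, !Cmod_R, Cmod_polar; apply Rle_refl.
- unfold X, Y, Cplus, Cmult, RtoC; simpl; f_equal; ring.
Qed.

Lemma homotopy_locally (t : R) :
  0 <= t <= 1 -> locally t (fun t' => forall s, Cmod (X t' s, Y t' s) < r).
Proof.
intros Ht.
assert (C : continuous (fun t => Rabs (1 - t) * Cmod (a, b) + Rabs t * rho) t).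
{ apply (continuous_plus (V := R_NormedModule));
    apply (continuous_mult (K := R_AbsRing)); try apply continuous_const.
  - apply continuous_comp; [|apply continuous_Rabs].
    apply (continuous_minus (V := R_NormedModule));
      [apply continuous_const|apply continuous_id].
  - apply continuous_Rabs. }
assert (B : Rabs (1 - t) * Cmod (a, b) + Rabs t * rho < r).
{ rewrite !Rabs_pos_eq by lra.
  assert ((1 - t) * Cmod (a, b) <= (1 - t) * rho); [|lra].
  apply Rmult_le_compat_l; lra. }
generalize (C _ (open_lt r _ B)); unfold filtermap; apply filter_imp.
intros t' Ht' s; eapply Rle_lt_trans; [apply homotopy_bound|exact Ht'].
Qed.

Lemma homotopy_continuous (t s : R) :
  continuous (fun z : R * R => X (fst z) (snd z)) (t, s) /\
  continuous (fun z : R * R => Y (fst z) (snd z)) (t, s).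
Proof.
split; (apply (continuous_plus (V := R_NormedModule));
  [apply continuous_const|]);
  apply (continuous_mult (K := R_AbsRing)); try apply continuous_fst;
  apply (continuous_minus (V := R_NormedModule)); try apply continuous_const;
  apply (continuous_mult (K := R_AbsRing)); try apply continuous_const;
  (apply continuous_comp; [apply continuous_snd|]).
- apply continuous_cos.
- apply continuous_sin.
Qed.

Variables (u v u' v' : R -> R -> R).
Hypothesis H : holomorphic_pair r u v u' v'.

(** With [F = u + i v] and [k = k1 + i k2], [Phi] is [Re (F(z_t) k)] and [G] is [Re (F'(z_t) z)]. *)
Let Phi (t s : R) := u (X t s) (Y t s) * k1 s - v (X t s) (Y t s) * k2 s.
Let G (t s : R) :=
  u' (X t s) (Y t s) * (rho * cos s) - v' (X t s) (Y t s) * (rho * sin s).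

(** The [t]-derivative of [z_t] is [z - w], and [(z - w) k = z] removes the kernel from the
    derivative. *)
Lemma is_derive_Phi (t s : R) :
  Cmod (X t s, Y t s) < r -> is_derive (fun t => Phi t s) t (G t s).
Proof.
intros Hts.
assert (DX : is_derive (fun t => X t s) t (rho * cos s - a))
  by (unfold X; auto_derive; [exact Logic.I|ring]).
assert (DY : is_derive (fun t => Y t s) t (rho * sin s - b))
  by (unfold Y; auto_derive; [exact Logic.I|ring]).
assert (DU := is_derive_along_curve _ _ _ _ _ (fun t => X t s) (fun t => Y t s)
  t _ _ H Hts DX DY).
assert (DV := is_derive_along_curve _ _ _ _ _ (fun t => X t s) (fun t => Y t s)
  t _ _ (holomorphic_pair_rotate _ _ _ _ _ H) Hts DX DY).
cbv beta in DU, DV.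
evar_last.
- apply (is_derive_minus (V := R_NormedModule));
    apply (is_derive_scal_l (V := R_NormedModule)); [exact DU|exact DV].
- transitivity (u' (X t s) (Y t s)
        * ((rho * cos s - a) * k1 s - (rho * sin s - b) * k2 s)
      - v' (X t s) (Y t s)
        * ((rho * cos s - a) * k2 s + (rho * sin s - b) * k1 s)).
  + unfold minus, plus, opp, scal; simpl; unfold mult; simpl; ring.
  + rewrite k_re, k_im; reflexivity.
Qed.

Lemma G_continuous (t s : R) :
  Cmod (X t s, Y t s) < r ->
  continuous (fun z : R * R => G (fst z) (snd z)) (t, s).
Proof.
intros Hts.
destruct (homotopy_continuous t s) as [CX CY].
destruct (H _ _ Hts) as (_ & _ & _ & _ & C1 & C2).
apply (continuous_minus (V := R_NormedModule));
  apply (continuous_mult (K := R_AbsRing)).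
- exact (continuous_comp_2 _ _ u' _ CX CY C1).
- apply (continuous_mult (K := R_AbsRing)); [apply continuous_const|].
  apply continuous_comp; [apply continuous_snd|apply continuous_cos].
- exact (continuous_comp_2 _ _ v' _ CX CY C2).
- apply (continuous_mult (K := R_AbsRing)); [apply continuous_const|].
  apply continuous_comp; [apply continuous_snd|apply continuous_sin].
Qed.

Lemma Phi_continuous (t s : R) :
  Cmod (X t s, Y t s) < r -> continuous (Phi t) s.
Proof.
intros Hts.
assert (CX : continuous (X t) s).
{ apply (ex_derive_continuous (V := R_NormedModule)); unfold X; auto_derive;
  exact Logic.I. }
assert (CY : continuous (Y t) s).
{ apply (ex_derive_continuous (V := R_NormedModule)); unfold Y; auto_derive;
  exact Logic.I. }
apply (continuous_minus (V := R_NormedModule));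
  apply (continuous_mult (K := R_AbsRing)); auto.
- exact (continuous_comp_2 _ _ u _ CX CY (continuous_holomorphic _ _ _ _ _ _ _ H Hts)).
- exact (continuous_comp_2 _ _ v _ CX CY
    (continuous_holomorphic _ _ _ _ _ _ _ (holomorphic_pair_rotate _ _ _ _ _ H) Hts)).
Qed.

(* [t G] is the derivative of [s |-> v (X t s) (Y t s)], which has period [2 pi]. *)
Lemma RInt_G (t : R) : 0 < t <= 1 -> RInt (G t) 0 (2 * PI) = 0.
Proof.
intros Ht.
assert (L : forall s, Cmod (X t s, Y t s) < r)
  by (apply (locally_singleton _ _ (homotopy_locally t ltac:(lra)))).
assert (I1 : is_RInt (fun s => t * G t s) 0 (2 * PI) 0).
{ replace 0 with (minus (v (X t (2 * PI)) (Y t (2 * PI))) (v (X t 0) (Y t 0))) at 2.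
  - apply (is_RInt_derive (V := R_CompleteNormedModule) (fun s => v (X t s) (Y t s))).
    + intros s _.
      evar_last.
      * apply (is_derive_along_curve _ _ _ _ _ (X t) (Y t) s
          (- t * rho * sin s) (t * rho * cos s)
          (holomorphic_pair_rotate _ _ _ _ _ H) (L s));
          unfold X, Y; auto_derive; try exact Logic.I; ring.
      * unfold G; ring.
    + intros s _; apply (continuous_mult (K := R_AbsRing)); [apply continuous_const|].
      exact (continuous_comp_2 (fun _ => t) (fun s => s) G s (continuous_const _ _)
        (continuous_id _) (G_continuous t s (L s))).
  - unfold X, Y; rewrite cos_2PI, sin_2PI, cos_0, sin_0.
    apply (minus_eq_zero (G := R_AbelianGroup)). }
apply is_RInt_unique.
apply (is_RInt_scal _ _ _ (/ t)) in I1.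
replace 0 with (scal (/ t) 0) at 2 by apply (scal_zero_r (V := R_ModuleSpace)).
eapply is_RInt_ext; [|exact I1].
intros s _; unfold scal; simpl; unfold mult; simpl; field; lra.
Qed.

Lemma is_derive_RInt_Phi (t : R) :
  0 <= t <= 1 ->
  is_derive (fun t => RInt (Phi t) 0 (2 * PI)) t (RInt (G t) 0 (2 * PI)).
Proof.
intros Ht.
assert (L := homotopy_locally t Ht).
evar_last.
- apply (is_derive_RInt_param Phi).
  + revert L; apply filter_imp; intros t' Ht' s _.
    eexists; apply is_derive_Phi; auto.
  + intros s _.
    (* Continuity is asked of the derivative as a function of two variables; it equals [G] for all
       [t] near the given one and all [s]. *)
    apply continuity_2d_pt_ext_loc with G.
    * destruct L as [e He]; exists e; intros x y Hx _.
      symmetry; apply is_derive_unique, is_derive_Phi, He; exact Hx.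
    * apply continuity_2d_pt_filterlim, G_continuous.
      apply (locally_singleton _ _ L).
  + revert L; apply filter_imp; intros t' Ht'.
    apply (ex_RInt_continuous (V := R_CompleteNormedModule)).
    intros s _; apply Phi_continuous; auto.
- apply RInt_ext; intros s _; apply is_derive_unique, is_derive_Phi.
  apply (locally_singleton _ _ L).
Qed.

(** At [t = 1] the integrand lives on the circle, at [t = 0] it is [Re (F(w) k)]. The integral of
    the kernel is left as it stands and evaluated later by a series. *)
Lemma cauchy_formula :
  RInt (fun s => u (rho * cos s) (rho * sin s) * k1 s
               - v (rho * cos s) (rho * sin s) * k2 s) 0 (2 * PI)
  = u a b * RInt k1 0 (2 * PI) - v a b * RInt k2 0 (2 * PI).
Proof.
assert (E : RInt (Phi 1) 0 (2 * PI) = RInt (Phi 0) 0 (2 * PI)).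
{ destruct (MVT_gen (fun t => RInt (Phi t) 0 (2 * PI)) 0 1 (fun _ => 0))
    as (c & _ & Hc).
  (* The derivative is known to vanish only for [t > 0]; the mean value theorem asks for it on the
     open interval and for mere continuity at the endpoints. *)
  - rewrite Rmin_left, Rmax_right by lra; intros t Ht.
    evar_last; [apply is_derive_RInt_Phi; lra|apply RInt_G; lra].
  - rewrite Rmin_left, Rmax_right by lra; intros t Ht.
    apply continuity_pt_filterlim.
    exact (ex_derive_continuous (V := R_NormedModule) _ _
      (ex_intro _ _ (is_derive_RInt_Phi t Ht))).
  - lra. }
rewrite <- (RInt_ext (Phi 1)), E.
- assert (I1 : ex_RInt k1 0 (2 * PI))
    by (apply (ex_RInt_continuous (V := R_CompleteNormedModule)); auto).
  assert (I2 : ex_RInt k2 0 (2 * PI))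
    by (apply (ex_RInt_continuous (V := R_CompleteNormedModule)); auto).
  apply is_RInt_unique.
  apply (is_RInt_ext (fun s => minus (scal (u a b) (k1 s)) (scal (v a b) (k2 s)))).
  { intros s _; unfold Phi, X, Y; rewrite !Rmult_0_l, !Rplus_0_r; reflexivity. }
  apply (is_RInt_minus (V := R_NormedModule));
    apply (is_RInt_scal (V := R_NormedModule));
    apply (RInt_correct (V := R_CompleteNormedModule)); assumption.
- intros s _; unfold Phi, X, Y; rewrite !Rmult_1_l, !Rplus_minus; reflexivity.
Qed.

End Cauchy.

(** * Geometric series under the integral sign *)

Definition ccontinuous (f : R -> C) : Prop :=
  forall s, continuous (fun s => Re (f s)) s /\ continuous (fun s => Im (f s)) s.

Lemma ccontinuous_const (c : C) : ccontinuous (fun _ => c).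
Proof. intros s; split; apply continuous_const. Qed.

Lemma ccontinuous_plus (f g : R -> C) :
  ccontinuous f -> ccontinuous g -> ccontinuous (fun s => f s + g s)%C.
Proof.
intros F G s; destruct (F s) as [F1 F2], (G s) as [G1 G2]; split.
- exact (continuous_plus (V := R_NormedModule) _ _ _ F1 G1).
- exact (continuous_plus (V := R_NormedModule) _ _ _ F2 G2).
Qed.

Lemma ccontinuous_mult (f g : R -> C) :
  ccontinuous f -> ccontinuous g -> ccontinuous (fun s => f s * g s)%C.
Proof.
intros F G s; destruct (F s) as [F1 F2], (G s) as [G1 G2]; split.
- exact (continuous_minus (V := R_NormedModule) _ _ _
    (continuous_mult (K := R_AbsRing) _ _ _ F1 G1)
    (continuous_mult (K := R_AbsRing) _ _ _ F2 G2)).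
- exact (continuous_plus (V := R_NormedModule) _ _ _
    (continuous_mult (K := R_AbsRing) _ _ _ F1 G2)
    (continuous_mult (K := R_AbsRing) _ _ _ F2 G1)).
Qed.

Lemma ccontinuous_pow (f : R -> C) (n : nat) :
  ccontinuous f -> ccontinuous (fun s => f s ^ n)%C.
Proof.
intros F; induction n as [|n IH]; simpl.
- apply ccontinuous_const.
- exact (ccontinuous_mult _ _ F IH).
Qed.

Lemma ccontinuous_inv (f : R -> C) :
  (forall s, f s <> 0%C) -> ccontinuous f -> ccontinuous (fun s => / f s)%C.
Proof.
intros N F s; destruct (F s) as [F1 F2].
assert (D : continuous (fun s => / (Re (f s) ^ 2 + Im (f s) ^ 2)) s).
{ apply continuous_Rinv_comp.
  - exact (continuous_plus (V := R_NormedModule) _ _ _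
      (continuous_comp _ (fun s => s ^ 2) s F1 (continuous_square _))
      (continuous_comp _ (fun s => s ^ 2) s F2 (continuous_square _))).
  - intros E; apply (N s), Cmod_eq_0; unfold Cmod.
    change (fst (f s)) with (Re (f s)); change (snd (f s)) with (Im (f s)).
    rewrite E; apply sqrt_0. }
split; apply (continuous_mult (K := R_AbsRing)); auto.
exact (continuous_opp _ _ F2).
Qed.

Lemma ccontinuous_Cmod (f : R -> C) (s : R) :
  ccontinuous f -> continuous (fun s => Cmod (f s)) s.
Proof.
intros F; destruct (F s) as [F1 F2].
apply (continuous_ext (fun s => Cmod (Re (f s), Im (f s)))).
- intros t; destruct (f t); reflexivity.
- exact (continuous_comp_2 _ _ (fun x y => Cmod (x, y)) _ F1 F2 (continuous_Cmod _ _)).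
Qed.

Lemma ex_RInt_Re (f : R -> C) (a b : R) :
  ccontinuous f -> ex_RInt (fun s => Re (f s)) a b.
Proof.
intros F; apply (ex_RInt_continuous (V := R_CompleteNormedModule)).
intros s _; destruct (F s) as [Fr Fi]; assumption.
Qed.

Lemma ex_RInt_Im (f : R -> C) (a b : R) :
  ccontinuous f -> ex_RInt (fun s => Im (f s)) a b.
Proof.
intros F; apply (ex_RInt_continuous (V := R_CompleteNormedModule)).
intros s _; destruct (F s) as [Fr Fi]; assumption.
Qed.

(** Telescoping: [w^n / (1 - w) = w^n + w^(n+1) / (1 - w)], so the partial sums are [J 0 - J (n+1)],
    where [J n] integrates [Re (f w^n / (1 - w))] and is bounded by [q^n] times a constant. *)
Lemma RInt_geometric (f w : R -> C) (q : R) (a b : R) :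
  a <= b -> q < 1 -> ccontinuous f -> ccontinuous w -> (forall s, Cmod (w s) <= q) ->
  is_series (fun n => RInt (fun s => Re (f s * w s ^ n)%C) a b)
    (RInt (fun s => Re (f s * / (1 - w s))%C) a b).
Proof.
intros ab q1 F W B.
assert (q0 : 0 <= q) by (eapply Rle_trans; [apply Cmod_ge_0|apply (B 0)]).
assert (N : forall s, (1 - w s)%C <> 0%C).
{ intros s E; specialize (B s).
  replace (w s) with (RtoC 1) in B by (rewrite <- (Cplus_0_r (w s)), <- E; ring).
  rewrite Cmod_1 in B; lra. }
set (k s := (/ (1 - w s))%C).
assert (K : ccontinuous k).
{ apply ccontinuous_inv; [exact N|].
  apply (ccontinuous_plus (fun _ => RtoC 1)); [apply ccontinuous_const|].
  intros s; destruct (W s); split;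
    apply (continuous_opp (V := R_NormedModule)); assumption. }
set (J n := RInt (fun s => Re (f s * w s ^ n * k s)%C) a b).
assert (FW : forall n, ccontinuous (fun s => f s * w s ^ n)%C)
  by exact (fun n => ccontinuous_mult _ _ F (ccontinuous_pow w n W)).
assert (FWK : forall n, ccontinuous (fun s => f s * w s ^ n * k s)%C)
  by exact (fun n => ccontinuous_mult _ _ (FW n) K).
set (c := (fun n => RInt (fun s => Re (f s * w s ^ n)%C) a b) : nat -> R).
assert (S1 : forall n, J n = c n + J (S n)).
{ intros n; unfold J, c.
  transitivity (RInt (fun s => plus (Re (f s * w s ^ n)%C)
    (Re (f s * w s ^ S n * k s)%C)) a b).
  - apply RInt_ext; intros s _.
    transitivity (Re (f s * w s ^ n + f s * w s ^ S n * k s)%C); [|reflexivity].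
    f_equal; rewrite Cpow_S; unfold k; field; apply N.
  - exact (RInt_plus (V := R_CompleteNormedModule)
      _ _ a b (ex_RInt_Re _ a b (FW n)) (ex_RInt_Re _ a b (FWK (S n)))). }
assert (S2 : forall n, sum_n c n = J 0%nat - J (S n)).
{ induction n as [|n IH].
  - rewrite sum_O, (S1 0%nat); change (c 0%nat = c 0%nat + J 1%nat - J 1%nat); ring.
  - rewrite sum_Sn, IH, (S1 (S n)); unfold plus; simpl;
    change (J 0%nat - (c (S n) + J (S (S n))) + c (S n) = J 0%nat - J (S (S n)));
    ring. }
assert (L : is_lim_seq J 0).
{ set (M := RInt (fun s => Cmod (f s * k s)%C) a b).
  apply is_lim_seq_abs_0.
  apply is_lim_seq_le_le with (fun _ => 0) (fun n => q ^ n * M).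
  - intros n; split; [apply Rabs_pos|].
    assert (E : ex_RInt (fun s => Cmod (f s * k s)%C) a b).
    { apply (ex_RInt_continuous (V := R_CompleteNormedModule)).
      intros s _; apply ccontinuous_Cmod, ccontinuous_mult; assumption. }
    eapply Rle_trans; [apply abs_RInt_le; [exact ab|]|].
    + exact (ex_RInt_Re _ a b (FWK n)).
    + unfold M; rewrite <- (RInt_scal (V := R_CompleteNormedModule)) by exact E.
      apply RInt_le; [exact ab| | |].
      * apply (ex_RInt_continuous (V := R_CompleteNormedModule)).
        intros s _; apply continuous_comp; [|apply continuous_Rabs].
        exact (proj1 (FWK n s)).
      * apply (ex_RInt_scal (V := R_NormedModule)); exact E.
      * intros s _; eapply Rle_trans; [apply re_le_Cmod|].
        replace (f s * w s ^ n * k s)%C with (w s ^ n * (f s * k s))%C by ring.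
        rewrite Cmod_mult, Cmod_pow; unfold scal; simpl; unfold mult; simpl.
        apply Rmult_le_compat_r; [apply Cmod_ge_0|].
        apply pow_incr; split; [apply Cmod_ge_0|apply B].
  - apply is_lim_seq_const.
  - replace (Finite 0) with (Rbar_mult 0 M) by (simpl; f_equal; ring).
    apply is_lim_seq_scal_r, is_lim_seq_geom; rewrite Rabs_pos_eq; lra. }
change (is_lim_seq (sum_n c) (RInt (fun s => Re (f s * k s)%C) a b)).
apply (is_lim_seq_ext (fun n => J 0%nat - J (S n))); [intros n; symmetry; apply S2|].
replace (RInt (fun s => Re (f s * k s)%C) a b) with (J 0%nat - 0).
- apply is_lim_seq_minus'; [apply is_lim_seq_const|].
  apply is_lim_seq_incr_1 in L; exact L.
- rewrite Rminus_0_r; apply RInt_ext; intros s _; f_equal; simpl; ring.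
Qed.

(** * Integrals of monomials over a circle *)

Definition circle (rho s : R) : C := (rho * cos s, rho * sin s).

Definition inv_circle (rho s : R) : C := (cos s / rho, - sin s / rho).

Lemma inv_circle_mult (rho s : R) :
  rho <> 0 -> (circle rho s * inv_circle rho s)%C = RtoC 1.
Proof.
intros H; unfold circle, inv_circle, Cmult, RtoC; simpl; f_equal; field_simplify; auto.
rewrite <- !Rsqr_pow2, Rplus_comm; apply sin2_cos2.
Qed.

Lemma Cmod_inv_circle (rho s : R) : 0 < rho -> Cmod (inv_circle rho s) = / rho.
Proof.
intros H.
assert (E := f_equal Cmod (inv_circle_mult rho s ltac:(lra))).
rewrite Cmod_mult, Cmod_1 in E.
unfold circle in E; rewrite Cmod_polar in E by exact H.
apply Rmult_eq_reg_l with rho; [rewrite E; field|]; lra.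
Qed.

Lemma inv_circle_pow (rho s : R) (n : nat) :
  rho <> 0 ->
  (inv_circle rho s ^ n)%C = (cos (INR n * s) / rho ^ n, - sin (INR n * s) / rho ^ n).
Proof.
intros H; induction n as [|n IH].
- simpl; rewrite Rmult_0_l, cos_0, sin_0; unfold RtoC; f_equal; field.
- rewrite Cpow_S, IH, S_INR.
  replace ((INR n + 1) * s) with (INR n * s + s) by ring.
  rewrite cos_plus, sin_plus.
  unfold inv_circle, Cmult; simpl; f_equal; field;
    split; auto; apply pow_nonzero; exact H.
Qed.

Lemma ccontinuous_inv_circle (rho : R) : ccontinuous (inv_circle rho).
Proof.
intros s; split; apply (ex_derive_continuous (V := R_NormedModule));
  unfold inv_circle, Rdiv; simpl; auto_derive; exact Logic.I.
Qed.

Lemma RInt_monomial_circle (rho : R) (c z : C) (n : nat) :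
  rho <> 0 ->
  RInt (fun s => Re (c * (z * inv_circle rho s) ^ n)%C) 0 (2 * PI)
  = match n with O => 2 * PI * Re c | _ => 0 end.
Proof.
intros H; destruct n as [|n].
- rewrite (RInt_ext _ (fun _ => Re c)).
  + rewrite RInt_const; unfold scal; simpl; unfold mult; simpl; ring.
  + intros s _; f_equal; apply Cmult_1_r.
- assert (N : INR (S n) <> 0) by (apply not_0_INR; discriminate).
  assert (P : rho ^ S n <> 0) by (apply pow_nonzero; exact H).
  set (d := (c * z ^ S n)%C).
  (* With [m = n + 1], this is a [2 pi]-periodic primitive of [Re (d e^(- i m s)) / rho^m], so the
     integral over a period is 0. *)
  set (A s := (Re d * sin (INR (S n) * s) - Im d * cos (INR (S n) * s))
    / (INR (S n) * rho ^ S n)).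
  apply is_RInt_unique.
  replace 0 with (minus (A (2 * PI)) (A 0)) at 2.
  + apply (is_RInt_ext (fun s => (Re d * cos (INR (S n) * s)
      + Im d * sin (INR (S n) * s)) / rho ^ S n)).
    { intros s _; rewrite Cpow_mult_l, inv_circle_pow by exact H.
      transitivity (Re (d * (cos (INR (S n) * s) / rho ^ S n,
        - sin (INR (S n) * s) / rho ^ S n)%R)%C).
      - unfold Cmult at 1, Re, Im; cbn [fst snd]; real_eq; field; exact P.
      - f_equal; unfold d; ring. }
    apply (is_RInt_derive (V := R_CompleteNormedModule) A).
    * intros s _; unfold A; revert N P.
      generalize (INR (S n)) (rho ^ S n) (Re d) (Im d); intros m t p q N P.
      auto_derive; [exact Logic.I|field; auto].
    * intros s _; apply (ex_derive_continuous (V := R_NormedModule)).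
      auto_derive; exact Logic.I.
  + unfold A; rewrite Rmult_0_r.
    replace (INR (S n) * (2 * PI)) with (0 + 2 * INR (S n) * PI) by ring.
    rewrite sin_period, cos_period.
    apply (minus_eq_zero (G := R_AbelianGroup)).
Qed.

Lemma is_series_single (l : R) :
  is_series (fun n => match n with O => l | _ => 0 end) l.
Proof.
set (c := (fun n => match n with O => l | _ => 0 end) : nat -> R).
change (is_lim_seq (sum_n c) l).
apply (is_lim_seq_ext (fun _ => l)); [|apply is_lim_seq_const].
induction n as [|n IH].
- rewrite sum_O; reflexivity.
- rewrite sum_Sn, <- IH; symmetry; apply (plus_zero_r (G := R_AbelianGroup)).
Qed.

(** * Power series from Cauchy's formula *)

Section Expansion.

Variables (r rho : R) (rho_pos : 0 < rho) (rho_lt : rho < r).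

Lemma Cmod_kernel_ratio (z : C) (s : R) : Cmod (z * inv_circle rho s) = Cmod z / rho.
Proof. rewrite Cmod_mult, Cmod_inv_circle by exact rho_pos; reflexivity. Qed.

Lemma kernel_ratio_lt (z : C) : Cmod z < rho -> Cmod z / rho < 1.
Proof. intros Hz; apply Rmult_lt_reg_r with rho; [|field_simplify]; lra. Qed.

Lemma ccontinuous_kernel_ratio (z : C) :
  ccontinuous (fun s => z * inv_circle rho s)%C.
Proof.
apply ccontinuous_mult; [apply ccontinuous_const|apply ccontinuous_inv_circle].
Qed.

Lemma kernel_denominator (z : C) (s : R) :
  Cmod z < rho -> (1 - z * inv_circle rho s)%C <> 0%C.
Proof.
intros Hz E.
assert (L := kernel_ratio_lt z Hz).
rewrite <- (Cmod_kernel_ratio z s) in L.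
replace (z * inv_circle rho s)%C with (1 - (1 - z * inv_circle rho s))%C in L by ring.
rewrite E in L.
replace (1 - 0)%C with (RtoC 1) in L by ring.
rewrite Cmod_1 in L; lra.
Qed.

(** Expanding [1 / (1 - z / zeta)] in powers of [z / zeta], [zeta] on the circle, only the constant
    term has a nonzero integral. *)
Lemma RInt_kernel (c z : C) :
  Cmod z < rho ->
  RInt (fun s => Re (c * / (1 - z * inv_circle rho s))%C) 0 (2 * PI) = 2 * PI * Re c.
Proof.
intros Hz.
assert (P := PI_RGT_0).
assert (S1 := RInt_geometric (fun _ => c) (fun s => z * inv_circle rho s)%C
  (Cmod z / rho) 0 (2 * PI) ltac:(lra) (kernel_ratio_lt z Hz) (ccontinuous_const c)
  (ccontinuous_kernel_ratio z) (fun s => Req_le _ _ (Cmod_kernel_ratio z s))).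
apply is_series_unique in S1; rewrite <- S1.
apply is_series_unique.
eapply is_series_ext; [|apply is_series_single].
intros n; symmetry; apply RInt_monomial_circle; lra.
Qed.

Definition boundary_value (u v : R -> R -> R) (s : R) : C :=
  (u (rho * cos s) (rho * sin s), v (rho * cos s) (rho * sin s)).

(** The real part of the Taylor coefficient of [F = u + i v]. Its imaginary part is the same
    expression for [- i F], that is, for the pair [(v, - u)]. *)
Definition cauchy_coeff (u v : R -> R -> R) (n : nat) : R :=
  / (2 * PI)
  * RInt (fun s => Re (boundary_value u v s * inv_circle rho s ^ n)%C) 0 (2 * PI).

Lemma ccontinuous_boundary_value (u v u' v' : R -> R -> R) :
  holomorphic_pair r u v u' v' -> ccontinuous (boundary_value u v).
Proof.
intros H s.
assert (CX : continuous (fun s => rho * cos s) s)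
  by (apply (ex_derive_continuous (V := R_NormedModule)); auto_derive; exact Logic.I).
assert (CY : continuous (fun s => rho * sin s) s)
  by (apply (ex_derive_continuous (V := R_NormedModule)); auto_derive; exact Logic.I).
assert (B : Cmod (rho * cos s, rho * sin s) < r) by (rewrite Cmod_polar; lra).
split.
- exact (continuous_comp_2 _ _ u _ CX CY (continuous_holomorphic _ _ _ _ _ _ _ H B)).
- exact (continuous_comp_2 _ _ v _ CX CY (continuous_holomorphic _ _ _ _ _ _ _
    (holomorphic_pair_rotate _ _ _ _ _ H) B)).
Qed.

Lemma cauchy_formula_kernel (u v u' v' : R -> R -> R) (a b : R) :
  holomorphic_pair r u v u' v' -> Cmod (a, b) < rho ->
  RInt (fun s => Re (boundary_value u v s * / (1 - (a, b) * inv_circle rho s))%C)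
    0 (2 * PI) = 2 * PI * u a b.
Proof.
intros H Hab.
set (k s := (/ (1 - (a, b) * inv_circle rho s))%C).
assert (K : ccontinuous k).
{ apply ccontinuous_inv.
  - intros s; apply kernel_denominator; exact Hab.
  - apply (ccontinuous_plus (fun _ => RtoC 1)); [apply ccontinuous_const|].
    intros s; destruct (ccontinuous_kernel_ratio (a, b) s); split;
      apply (continuous_opp (V := R_NormedModule)); assumption. }
assert (E : forall s, ((circle rho s - (a, b)) * k s)%C = circle rho s).
{ intros s.
  replace (circle rho s - (a, b))%C
    with (circle rho s * (1 - (a, b) * inv_circle rho s))%C.
  - unfold k; field; apply kernel_denominator; exact Hab.
  - transitivity (circle rho s - (a, b) * (circle rho s * inv_circle rho s))%C; [ring|].
    rewrite inv_circle_mult by lra; ring. }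
(* The factors [1] and [- i] extract the integrals of [Re k] and [Im k], which are [2 pi] and 0;
   hence the [v] term of Cauchy's formula disappears. *)
assert (Kre := RInt_kernel 1 (a, b) Hab).
assert (Kim := RInt_kernel (- Ci) (a, b) Hab).
rewrite (RInt_ext _ (fun s => Re (k s))) in Kre
  by (intros s _; unfold k; f_equal; ring).
rewrite (RInt_ext _ (fun s => Im (k s))) in Kim
  by (intros s _; change (Re (- Ci * k s)%C = Im (k s));
      unfold Ci, Copp, Cmult, Re, Im; simpl; ring).
assert (F := cauchy_formula r rho a b (fun s => Re (k s)) (fun s => Im (k s))
  rho_pos rho_lt Hab (fun s => proj1 (K s)) (fun s => proj2 (K s))
  (fun s => f_equal Re (E s)) (fun s => f_equal Im (E s)) u v u' v' H).
cbv beta in F; rewrite Kre, Kim in F.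
transitivity (u a b * (2 * PI * Re 1) - v a b * (2 * PI * Re (- Ci))).
- exact F.
- unfold Ci, Copp, Re, RtoC; simpl; real_eq; ring.
Qed.

(** The geometric expansion of the kernel is now applied with the boundary values as factor, and
    [w^n] is pulled out of the real part of each term. *)
Lemma is_series_holomorphic (u v u' v' : R -> R -> R) (a b : R) :
  holomorphic_pair r u v u' v' -> Cmod (a, b) < rho ->
  is_series (fun n => Re ((a, b) ^ n)%C * cauchy_coeff u v n
                    - Im ((a, b) ^ n)%C * cauchy_coeff v (fun x y => - u x y) n)
    (u a b).
Proof.
intros H Hab.
assert (P := PI_RGT_0).
assert (BC := ccontinuous_boundary_value _ _ _ _ H).
assert (S1 := RInt_geometric (boundary_value u v) (fun s => (a, b) * inv_circle rho s)%C
  (Cmod (a, b) / rho) 0 (2 * PI) ltac:(lra) (kernel_ratio_lt (a, b) Hab) BC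
  (ccontinuous_kernel_ratio (a, b))
  (fun s => Req_le _ _ (Cmod_kernel_ratio (a, b) s))).
cbv beta in S1; rewrite (cauchy_formula_kernel u v u' v' a b H Hab) in S1.
apply (is_series_scal (/ (2 * PI))) in S1.
replace (u a b) with (scal (/ (2 * PI)) (2 * PI * u a b))
  by (unfold scal; simpl; unfold mult; simpl; field; lra).
eapply is_series_ext; [|exact S1].
intros n; unfold cauchy_coeff.
set (B s := (boundary_value u v s * inv_circle rho s ^ n)%C).
assert (CB : ccontinuous B).
{ apply ccontinuous_mult; [exact BC|].
  apply ccontinuous_pow, ccontinuous_inv_circle. }
rewrite (RInt_ext (fun s => Re (boundary_value u v s * ((a, b) * inv_circle rho s) ^ n)%C)
  (fun s => minus (scal (Re ((a, b) ^ n)%C) (Re (B s)))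
                  (scal (Im ((a, b) ^ n)%C) (Im (B s))))).
2: { intros s _; rewrite Cpow_mult_l.
  transitivity (Re ((a, b) ^ n * B s)%C); [f_equal; unfold B; ring|reflexivity]. }
rewrite (RInt_ext (fun s => Re (boundary_value v (fun x y => - u x y)%R s
    * inv_circle rho s ^ n)%C) (fun s => Im (B s))).
2: { intros s _; unfold B, boundary_value, Cmult, Re, Im; cbn [fst snd]; real_eq; ring. }
rewrite (RInt_minus (V := R_CompleteNormedModule)),
  !(RInt_scal (V := R_CompleteNormedModule)).
- unfold minus, plus, opp, scal; simpl; unfold mult; simpl; fold (B); ring.
- apply ex_RInt_Im; exact CB.
- apply ex_RInt_Re; exact CB.
- apply (ex_RInt_scal (V := R_NormedModule)), ex_RInt_Re; exact CB.
- apply (ex_RInt_scal (V := R_NormedModule)), ex_RInt_Im; exact CB.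
Qed.

End Expansion.

Lemma holomorphic_expansion (r rho : R) (u v u' v' : R -> R -> R) :
  0 < rho < r -> holomorphic_pair r u v u' v' ->
  exists al be : nat -> R, forall x y, Cmod (x, y) < rho ->
    is_series (fun n => Re ((x, y) ^ n)%C * al n - Im ((x, y) ^ n)%C * be n) (u x y) /\
    is_series (fun n => Re ((x, y) ^ n)%C * be n + Im ((x, y) ^ n)%C * al n) (v x y).
Proof.
intros [H0 H1] H.
exists (cauchy_coeff rho u v), (cauchy_coeff rho v (fun x y => - u x y)).
intros x y Hxy; split.
- exact (is_series_holomorphic r rho H0 H1 u v u' v' x y H Hxy).
- assert (S1 := is_series_holomorphic r rho H0 H1 _ _ _ _ x y
    (holomorphic_pair_rotate _ _ _ _ _ H) Hxy).
  eapply is_series_ext; [|exact S1].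
  intros n; cbv beta.
  (* The expansion of [v] is that of [- i F], whose coefficients are [be - i al]; rotating twice
     gives [- F], hence the sign. *)
  assert (E : cauchy_coeff rho (fun x y => - u x y) (fun x y => - v x y) n
    = - cauchy_coeff rho u v n).
  { unfold cauchy_coeff; rewrite Ropp_mult_distr_r; f_equal.
    rewrite <- (RInt_opp (V := R_CompleteNormedModule)).
    - apply RInt_ext; intros s _.
      unfold boundary_value, Cmult, opp, Re; cbn [fst snd]; simpl; real_eq; ring.
    - apply ex_RInt_Re, ccontinuous_mult.
      + exact (ccontinuous_boundary_value r rho H0 H1 _ _ _ _ H).
      + apply ccontinuous_pow, ccontinuous_inv_circle. }
  rewrite E; real_eq; ring.
Qed.

(** * Expansion of slice regular functions *)

Lemma power_series_coeff_unique (rho : R) (g : R -> R) (c d : nat -> R) (n : nat) :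
  0 < rho ->
  (forall x, Rabs x < rho -> is_series (fun n => x ^ n * c n) (g x)) ->
  (forall x, Rabs x < rho -> is_series (fun n => x ^ n * d n) (g x)) ->
  c n = d n.
Proof.
intros H Hc Hd.
assert (CV : forall e : nat -> R,
  (forall x, Rabs x < rho -> is_series (fun n => x ^ n * e n) (g x)) ->
  Rbar_lt 0 (CV_radius e)).
{ intros e He.
  assert (B : Rabs (rho / 2) = rho / 2) by (rewrite Rabs_pos_eq; lra).
  (* Convergence at the single point [rho / 2] bounds the radius of convergence from below. *)
  apply Rbar_lt_le_trans with (Finite (Rabs (rho / 2))); [simpl; lra|].
  apply Rbar_not_lt_le; intros L; apply (CV_disk_outside _ _ L).
  apply ex_series_lim_0; exists (g (rho / 2)).
  eapply is_series_ext; [|apply He; lra].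
  intros k; apply Rmult_comm. }
assert (PS : forall e : nat -> R,
  (forall x, Rabs x < rho -> is_series (fun n => x ^ n * e n) (g x)) ->
  forall x, Rabs x < rho -> PSeries e x = g x).
{ intros e He x Hx; apply is_pseries_unique, is_pseries_R.
  eapply is_series_ext; [|apply He, Hx].
  intros k; apply Rmult_comm. }
apply PSeries_ext_recip; [exact (CV c Hc)|exact (CV d Hd)|].
exists (mkposreal rho H); intros x Hx.
assert (Hx' : Rabs x < rho).
{ rewrite <- (Rminus_0_r x); exact Hx. }
rewrite (PS c Hc), (PS d Hd); auto.
Qed.

(** * Real functionals on the quaternions and on slices *)

Lemma quat_ext (p q : quat) :
  qre p = qre q -> qi p = qi q -> qj p = qj q -> qk p = qk q -> p = q.
Proof. destruct p, q; simpl; intros; subst; reflexivity. Qed.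

(* Convergence in the quaternions is tested against the real functionals
   [h |-> Re (p h)], which turns it into convergence of real series. *)
Definition qpair (p h : quat) : R := qre (qmult p h).

Lemma qpair_comb (p h : quat) :
  qpair p h = qre p * qre h - qi p * qi h - qj p * qj h - qk p * qk h.
Proof. reflexivity. Qed.

Lemma qre_le_qnorm (q : quat) : Rabs (qre q) <= qnorm q.
Proof.
rewrite <- (Rabs_pos_eq (qnorm q)) by apply qnorm_ge0.
apply Rsqr_le_abs_0; rewrite !Rsqr_pow2, qnorm_sq.
assert (H1 := pow2_ge_0 (qi q)); assert (H2 := pow2_ge_0 (qj q));
  assert (H3 := pow2_ge_0 (qk q)); lra.
Qed.

Lemma qnorm_le_sum (q : quat) :
  qnorm q <= Rabs (qre q) + Rabs (qi q) + Rabs (qj q) + Rabs (qk q).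
Proof.
assert (Ha := Rabs_pos (qre q)); assert (Hb := Rabs_pos (qi q));
  assert (Hc := Rabs_pos (qj q)); assert (Hd := Rabs_pos (qk q)).
apply Rsqr_incr_0_var; [|lra].
rewrite !Rsqr_pow2, qnorm_sq.
rewrite <- (pow2_abs (qre q)), <- (pow2_abs (qi q)), <- (pow2_abs (qj q)),
  <- (pow2_abs (qk q)).
nra.
Qed.

Lemma is_linear_qpair (p : quat) :
  is_linear (K := R_AbsRing) (U := quat_R_NormedModule) (V := R_NormedModule) (qpair p).
Proof.
split.
- intros x y; unfold qpair; cbn; unfold plus; cbn; ring.
- intros k x; unfold qpair, scal; cbn; unfold mult; cbn; ring.
(* The bound must be strictly positive even for [p = 0], hence the [+ 1]. *)
- exists (qnorm p + 1); split; [assert (H := qnorm_ge0 p); lra|].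
  intros h; change (Rabs (qre (qmult p h)) <= (qnorm p + 1) * qnorm h).
  eapply Rle_trans; [apply qre_le_qnorm|rewrite qnorm_mult].
  assert (H := qnorm_ge0 h); lra.
Qed.

Lemma continuous_qpair (p q : quat) :
  continuous (T := quat_UniformSpace) (U := R_UniformSpace) (qpair p) q.
Proof.
exact (filterdiff_continuous (K := R_AbsRing) (U := quat_R_NormedModule)
  (V := R_NormedModule) (qpair p) q
  (ex_intro _ _ (filterdiff_linear _ (is_linear_qpair p)))).
Qed.

Lemma is_derive_qpair (p : quat) (g : R -> quat) (x : R) (l : quat) :
  is_derive (K := R_AbsRing) (V := quat_R_NormedModule) g x l ->
  is_derive (fun t => qpair p (g t)) x (qpair p l).
Proof.
intros H.
eapply filterdiff_ext_lin.
- exact (filterdiff_comp' (V := quat_R_NormedModule) (W := R_NormedModule) g (qpair p)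
    x _ _ H (filterdiff_linear _ (is_linear_qpair p))).
- intros t; apply (linear_scal _ (is_linear_qpair p)).
Qed.

(** The imaginary components of [I^2] are [2 Re(I)] times those of [I]; a nonzero real part would
    make [I] real with square [- 1]. *)
Lemma imaginary_unit_spec (I : quat) :
  imaginary_unit I <-> qre I = 0 /\ qi I ^ 2 + qj I ^ 2 + qk I ^ 2 = 1.
Proof.
unfold imaginary_unit; split.
- intros H.
  assert (A := f_equal qre H); assert (B := f_equal qi H);
    assert (C := f_equal qj H); assert (D := f_equal qk H); cbn in A, B, C, D.
  destruct (Req_dec (qre I) 0) as [Z|Z]; [split; [exact Z|rewrite Z in A; lra]|].
  exfalso.
  assert (qi I = 0) by (apply Rmult_eq_reg_l with (2 * qre I); lra).
  assert (qj I = 0) by (apply Rmult_eq_reg_l with (2 * qre I); lra).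
  assert (qk I = 0) by (apply Rmult_eq_reg_l with (2 * qre I); lra).
  assert (P := pow2_ge_0 (qre I)).
  replace (qi I) with 0 in A; replace (qj I) with 0 in A; replace (qk I) with 0 in A.
  lra.
- intros [Z N]; apply quat_ext; cbn; rewrite Z; lra.
Qed.

Lemma qnorm_slice_point (I : quat) (x y : R) :
  imaginary_unit I -> qnorm (slice_point I x y) = Cmod (x, y).
Proof.
intros H; apply imaginary_unit_spec in H; destruct H as [Z N].
unfold qnorm, Cmod; f_equal; cbn [fst snd].
transitivity (x ^ 2 + y ^ 2 * (qi I ^ 2 + qj I ^ 2 + qk I ^ 2)).
- unfold slice_point; cbn; rewrite Z; ring.
- rewrite N; ring.
Qed.

(* [Re (slice_rotate I p h) = - Re (p I h)], the imaginary part, with respect to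
   [I], of the [L_I]-linear extension of [h |-> Re (p h)]. *)
Definition slice_rotate (I p : quat) : quat := qopp (qmult p I).

(** Slice regularity says [fx = - I fy], so [Re (p fx) = Re (- p I fy)] and
    [Re (p fy) = Re (p I fx)]: these are the Cauchy-Riemann equations of the pair. *)
Lemma holomorphic_slice (r : R) (f : quat -> quat) (I p : quat) :
  slice_regular r f -> imaginary_unit I ->
  exists u' v', holomorphic_pair r
    (fun x y => qpair p (f (slice_point I x y)))
    (fun x y => qpair (slice_rotate I p) (f (slice_point I x y))) u' v'.
Proof.
intros Hf HI.
destruct (Hf I HI) as (fx & fy & H).
exists (fun x y => qpair p (fx x y)), (fun x y => qpair (slice_rotate I p) (fx x y)).
intros x y Hxy.
rewrite <- (qnorm_slice_point I x y HI) in Hxy.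
destruct (H x y Hxy) as (H1 & H2 & H3 & H4 & H5).
assert (E : fx x y = qopp (qmult I (fy x y))).
{ assert (A := fun g : quat -> R => f_equal g H5).
  unfold qscal, qplus, qreal in A; simpl in A.
  apply quat_ext; [specialize (A qre)|specialize (A qi)|specialize (A qj)
    |specialize (A qk)]; simpl in A; simpl; lra. }
assert (E1 : - qpair (slice_rotate I p) (fx x y) = qpair p (fy x y)).
{ rewrite E.
  transitivity (- qpair p (qmult (qmult I I) (fy x y))).
  - unfold slice_rotate, qpair; cbn; ring.
  - rewrite HI; unfold qpair; cbn; ring. }
assert (E2 : qpair p (fx x y) = qpair (slice_rotate I p) (fy x y)).
{ rewrite E; unfold slice_rotate, qpair; cbn; ring. }
refine (conj (is_derive_qpair p _ x _ H1) (conj _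
  (conj (is_derive_qpair _ _ x _ H1) (conj _ (conj _ _))))); cbv beta.
- rewrite E1; exact (is_derive_qpair p _ y _ H2).
- rewrite E2; exact (is_derive_qpair _ _ y _ H2).
- apply (continuous_comp _ (qpair p) (x, y) H3), continuous_qpair.
- apply (continuous_comp _ (qpair _) (x, y) H3), continuous_qpair.
Qed.

Lemma pow_n_slice_point (I : quat) (x y : R) (n : nat) :
  imaginary_unit I ->
  pow_n (K := quat_AbsRing) (slice_point I x y) n
  = slice_point I (Re ((x, y) ^ n)%C) (Im ((x, y) ^ n)%C).
Proof.
intros H; apply imaginary_unit_spec in H; destruct H as [Z N].
induction n as [|n IH].
- apply quat_ext; cbn; ring.
- change (qmult (slice_point I x y) (pow_n (K := quat_AbsRing) (slice_point I x y) n)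
    = slice_point I (Re ((x, y) ^ S n)%C) (Im ((x, y) ^ S n)%C)).
  rewrite IH, Cpow_S; destruct ((x, y) ^ n)%C as [P Q].
  apply quat_ext; cbn; rewrite ?Z; try ring.
  transitivity (x * P - y * Q * (qi I ^ 2 + qj I ^ 2 + qk I ^ 2));
    [|rewrite N]; ring.
Qed.

Lemma qpair_slice_point (I p h : quat) (x y : R) :
  qpair p (qmult (slice_point I x y) h) = x * qpair p h + y * qpair (qmult p I) h.
Proof. unfold qpair, slice_point; cbn; ring. Qed.

Lemma sum_n_qpair (p : quat) (t : nat -> quat) (n : nat) :
  qpair p (sum_n (G := quat_AbelianMonoid) t n) = sum_n (fun n => qpair p (t n)) n.
Proof.
induction n as [|n IH].
- rewrite !sum_O; reflexivity.
- rewrite !sum_Sn, <- IH; apply (linear_plus _ (is_linear_qpair p)).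
Qed.

Lemma is_series_qpair (t : nat -> quat) (l : quat) :
  is_series (K := quat_AbsRing) (V := AbsRing_NormedModule quat_AbsRing) t l <->
  forall p, is_series (fun n => qpair p (t n)) (qpair p l).
Proof.
split.
- intros H p.
  apply (filterlim_ext (fun n => qpair p (sum_n (G := quat_AbelianMonoid) t n))).
  + intros n; apply sum_n_qpair.
  + exact (filterlim_comp _ _ _ _ _ _ _ _ H (continuous_qpair p l)).
- intros H.
  assert (L : forall p (eps : R), 0 < eps -> eventually (fun n =>
    Rabs (qpair p (qplus (sum_n (G := quat_AbelianMonoid) t n) (qopp l))) < eps)).
  { intros p eps He.
    assert (N : locally (qpair p l) (fun s => Rabs (s - qpair p l) < eps))
      by (exists (mkposreal eps He); intros s Hs; exact Hs).
    generalize (H p _ N); unfold filtermap; apply filter_imp; intros n.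
    rewrite <- sum_n_qpair; intros Hn; eapply Rle_lt_trans; [|exact Hn].
    apply Req_le; f_equal; unfold qpair; cbn; ring. }
  intros P [eps HP].
  assert (E4 : 0 < eps / 4) by (destruct eps; simpl; lra).
  (* The functionals given by [1], [- i], [- j], [- k] read off the four coordinates, each kept
     below [eps / 4]. *)
  generalize (filter_and _ _
    (filter_and _ _ (L (Quat 1 0 0 0) _ E4) (L (Quat 0 (-1) 0 0) _ E4))
    (filter_and _ _ (L (Quat 0 0 (-1) 0) _ E4) (L (Quat 0 0 0 (-1)) _ E4))).
  unfold filtermap; apply filter_imp; intros n [[A B] [C D]].
  apply HP.
  change (qnorm (qplus (sum_n (G := quat_AbelianMonoid) t n) (qopp l)) < eps).
  revert A B C D; generalize (qplus (sum_n (G := quat_AbelianMonoid) t n) (qopp l)).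
  intros d; rewrite !qpair_comb; simpl.
  replace (1 * qre d - _ - _ - _) with (qre d) by ring.
  replace (0 * qre d - -1 * qi d - _ - _) with (qi d) by ring.
  replace (0 * qre d - _ - -1 * qj d - _) with (qj d) by ring.
  replace (0 * qre d - _ - _ - -1 * qk d) with (qk d) by ring.
  intros A B C D; eapply Rle_lt_trans; [apply qnorm_le_sum|lra].
Qed.

(** Powers of [x + y I] have coordinates [Re ((x, y)^n)] and [Im ((x, y)^n)], the same for every
    [I]; the unit enters only through the functional [p I]. *)
Lemma is_qseries_slice (a : nat -> quat) (I : quat) (x y : R) (l : quat) :
  imaginary_unit I ->
  is_qseries a (slice_point I x y) l <->
  forall p, is_series (fun n => Re ((x, y) ^ n)%C * qpair p (a n)
                              + Im ((x, y) ^ n)%C * qpair (qmult p I) (a n)) (qpair p l).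
Proof.
intros HI.
unfold is_qseries, is_pseries; rewrite is_series_qpair.
assert (E : forall p n, qpair p (scal (pow_n (K := quat_AbsRing) (slice_point I x y) n)
    (a n : AbsRing_NormedModule quat_AbsRing))
  = Re ((x, y) ^ n)%C * qpair p (a n) + Im ((x, y) ^ n)%C * qpair (qmult p I) (a n)).
{ intros p n; rewrite pow_n_slice_point by exact HI; apply qpair_slice_point. }
split; intros H p; specialize (H p); (eapply is_series_ext; [|exact H]);
  intros n; [|symmetry]; apply E.
Qed.

Lemma slice_point_0 (I : quat) (x : R) : slice_point I x 0 = qreal x.
Proof. apply quat_ext; cbn; ring. Qed.

(** The last two clauses, the case [y = 0], tie [al] and [be] to functions on the real axis, so that
    expansions on different slices can be compared. *)
Lemma slice_expansion (r rho : R) (f : quat -> quat) (I p : quat) :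
  0 < rho < r -> slice_regular r f -> imaginary_unit I ->
  exists al be : nat -> R,
    (forall x y, Cmod (x, y) < rho ->
      is_series (fun n => Re ((x, y) ^ n)%C * al n - Im ((x, y) ^ n)%C * be n)
        (qpair p (f (slice_point I x y)))) /\
    (forall x, Rabs x < rho -> is_series (fun n => x ^ n * al n) (qpair p (f (qreal x)))) /\
    (forall x, Rabs x < rho ->
      is_series (fun n => x ^ n * be n) (qpair (slice_rotate I p) (f (qreal x)))).
Proof.
intros Hr Hf HI.
destruct (holomorphic_slice r f I p Hf HI) as (u' & v' & H).
destruct (holomorphic_expansion r rho _ _ u' v' Hr H) as (al & be & E).
assert (PR : forall x n, ((x, 0) ^ n)%C = RtoC (x ^ n))
  by (intros x n; symmetry; apply RtoC_pow).
exists al, be; split; [|split].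
- intros x y Hxy; exact (proj1 (E x y Hxy)).
- intros x Hx; rewrite <- (slice_point_0 I), <- (Cmod_R x) in *.
  destruct (E x 0 Hx) as [S1 _].
  eapply is_series_ext; [|exact S1].
  intros n; cbv beta; rewrite PR; simpl; real_eq; ring.
- intros x Hx; rewrite <- (slice_point_0 I), <- (Cmod_R x) in *.
  destruct (E x 0 Hx) as [_ S1].
  eapply is_series_ext; [|exact S1].
  intros n; cbv beta; rewrite PR; simpl; real_eq; ring.
Qed.

Lemma imaginary_unit_i : imaginary_unit (Quat 0 1 0 0).
Proof. apply imaginary_unit_spec; cbn; lra. Qed.

Lemma slice_coordinates (q : quat) :
  exists I x y, imaginary_unit I /\ q = slice_point I x y.
Proof.
set (y := sqrt (qi q ^ 2 + qj q ^ 2 + qk q ^ 2)).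
assert (N := pow2_sqrt (qi q ^ 2 + qj q ^ 2 + qk q ^ 2) ltac:(nra)); fold y in N.
destruct (Req_dec y 0) as [Z|Z].
- exists (Quat 0 1 0 0), (qre q), 0; split; [exact imaginary_unit_i|].
  rewrite slice_point_0; rewrite Z in N; apply quat_ext; cbn; nra.
- exists (Quat 0 (qi q / y) (qj q / y) (qk q / y)), (qre q), y; split.
  + apply imaginary_unit_spec; cbn [qre qi qj qk]; split; [reflexivity|].
    transitivity ((qi q ^ 2 + qj q ^ 2 + qk q ^ 2) / y ^ 2); [field; exact Z|].
    rewrite <- N; field; exact Z.
  + apply quat_ext; cbn; field; exact Z.
Qed.

Lemma real_axis_expansion (r : R) (f : quat -> quat) :
  0 < r -> slice_regular r f ->
  exists a : nat -> quat, forall p x, Rabs x < r / 2 ->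
    is_series (fun n => x ^ n * qpair p (a n)) (qpair p (f (qreal x))).
Proof.
intros Hr Hf.
assert (E : forall p, exists al : nat -> R, forall x, Rabs x < r / 2 ->
  is_series (fun n => x ^ n * al n) (qpair p (f (qreal x)))).
{ intros p.
  destruct (slice_expansion r (r / 2) f (Quat 0 1 0 0) p ltac:(lra) Hf imaginary_unit_i)
    as (al & _ & _ & H & _).
  exists al; exact H. }
(* The sequences in [E] depend on [p]; the four coordinate functionals define one quaternionic
   sequence, and linearity in [p] gives all others. *)
destruct (E (Quat 1 0 0 0)) as [a0 H0], (E (Quat 0 (-1) 0 0)) as [a1 H1],
  (E (Quat 0 0 (-1) 0)) as [a2 H2], (E (Quat 0 0 0 (-1))) as [a3 H3].
exists (fun n => Quat (a0 n) (a1 n) (a2 n) (a3 n)); intros p x Hx.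
assert (S1 := is_series_minus _ _ _ _
  (is_series_minus _ _ _ _ (is_series_scal (qre p) _ _ (H0 x Hx))
                           (is_series_scal (qi p) _ _ (H1 x Hx)))
  (is_series_plus _ _ _ _ (is_series_scal (qj p) _ _ (H2 x Hx))
                          (is_series_scal (qk p) _ _ (H3 x Hx)))).
evar_last; [eapply is_series_ext; [|exact S1]|].
- intros n; rewrite qpair_comb; cbn; unfold mult; cbn; real_eq; ring.
- rewrite !qpair_comb; cbn; unfold mult; cbn; real_eq; ring.
Qed.

Lemma regular_expansion (r : R) (f : quat -> quat) :
  0 < r -> slice_regular r f ->
  exists a : nat -> quat, forall q, in_ball r q -> is_qseries a q (f q).
Proof.
intros Hr Hf.
destruct (real_axis_expansion r f Hr Hf) as [a Ha].
exists a; intros q Hq.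
destruct (slice_coordinates q) as (I & x & y & HI & ->).
unfold in_ball in Hq; rewrite (qnorm_slice_point I x y HI) in Hq.
apply is_qseries_slice; [exact HI|]; intros p.
assert (B := Cmod_ge_0 (x, y)).
(* This radius exceeds the modulus of the point, stays below [r], and is at least [r / 2], so both
   expansions hold for [|x| < r / 2] and their coefficients agree. *)
destruct (slice_expansion r ((Cmod (x, y) + r) / 2) f I p ltac:(lra) Hf HI)
  as (al & be & H & H1 & H2).
assert (Ea : forall n, al n = qpair p (a n)).
{ intros n.
  apply (power_series_coeff_unique (r / 2) (fun x => qpair p (f (qreal x)))
    al (fun n => qpair p (a n))); [lra| |exact (Ha p)].
  intros t Ht; apply H1; lra. }
assert (Eb : forall n, be n = - qpair (qmult p I) (a n)).
{ intros n; transitivity (qpair (slice_rotate I p) (a n)).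
  - apply (power_series_coeff_unique (r / 2)
      (fun x => qpair (slice_rotate I p) (f (qreal x)))
      be (fun n => qpair (slice_rotate I p) (a n))); [lra| |exact (Ha _)].
    intros t Ht; apply H2; lra.
  - unfold slice_rotate; rewrite !qpair_comb; cbn; ring. }
eapply is_series_ext; [|apply H; lra].
intros n; cbv beta; rewrite Ea, Eb; real_eq; ring.
Qed.

Lemma qseries_unique (a : nat -> quat) (q l : quat) :
  is_qseries a q l -> qseries a q = l.
Proof.
intros H.
assert (H' : is_qseries a q (qseries a q))
  by exact (epsilon_spec _ _ (ex_intro _ l H)).
assert (E := fun p => eq_trans
  (eq_sym (is_series_unique _ _ (proj1 (is_series_qpair _ _) H' p)))
  (is_series_unique _ _ (proj1 (is_series_qpair _ _) H p))).
assert (E0 := E (Quat 1 0 0 0)); assert (E1 := E (Quat 0 1 0 0));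
  assert (E2 := E (Quat 0 0 1 0)); assert (E3 := E (Quat 0 0 0 1)).
rewrite !qpair_comb in E0, E1, E2, E3; cbn in E0, E1, E2, E3.
apply quat_ext; lra.
Qed.

Lemma regular_coeff_spec (r : R) (f : quat -> quat) :
  0 < r -> slice_regular r f ->
  forall q, in_ball r q -> is_qseries (regular_coeff r f) q (f q).
Proof. intros Hr Hf; exact (epsilon_spec _ _ (regular_expansion r f Hr Hf)). Qed.

(** * Values on the spheres [x + y S] and comparison of norms *)

Lemma imaginary_unit_opp (I : quat) : imaginary_unit I -> imaginary_unit (qopp I).
Proof.
intros H; apply imaginary_unit_spec in H; apply imaginary_unit_spec; cbn in *; lra.
Qed.

Lemma in_ball_slice_point (r : R) (I J : quat) (x y : R) :
  imaginary_unit I -> imaginary_unit J ->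
  in_ball r (slice_point I x y) -> in_ball r (slice_point J x y).
Proof.
unfold in_ball; intros HI HJ; rewrite !qnorm_slice_point by assumption; auto.
Qed.

Lemma qpair_conj (p h : quat) : qpair p (qconj h) = qpair (qconj p) h.
Proof. rewrite !qpair_comb; cbn; ring. Qed.

(* On the sphere [x + y S] the power series is affine in the imaginary unit,
   since [(x + y J)^n] is. *)
Lemma sphere_values (r : R) (f : quat -> quat) (I : quat) (x y : R) :
  0 < r -> slice_regular r f -> imaginary_unit I -> in_ball r (slice_point I x y) ->
  exists b c, forall J, imaginary_unit J ->
    f (slice_point J x y) = qplus b (qmult J c) /\
    regular_conj r f (slice_point J x y) = qplus (qconj b) (qmult J (qconj c)).
Proof.
intros Hr Hf HI Hq.
set (a := regular_coeff r f).
assert (Ha : forall q, in_ball r q -> is_qseries a q (f q))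
  by exact (regular_coeff_spec r f Hr Hf).
assert (HI' := imaginary_unit_opp I HI).
set (fp := f (slice_point I x y)).
set (fm := f (slice_point (qopp I) x y)).
assert (Sp := proj1 (is_qseries_slice a I x y fp HI) (Ha _ Hq)).
assert (Sm := proj1 (is_qseries_slice a _ x y fm HI')
  (Ha _ (in_ball_slice_point r I _ x y HI HI' Hq))).
(* Solving [fp = b + I c] and [fm = b - I c]. The next two claims say that [b] and [c] are the sums
   of [Re ((x, y)^n) a_n] and [Im ((x, y)^n) a_n], so they do not depend on [I]. *)
set (b := qscal (/ 2) (qplus fp fm)).
set (c := qscal (/ 2) (qmult I (qplus fm (qopp fp)))).
assert (Sb : forall p, is_series (fun n => Re ((x, y) ^ n)%C * qpair p (a n)) (qpair p b)).
{ intros p.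
  assert (S1 := is_series_scal (/ 2) _ _ (is_series_plus _ _ _ _ (Sp p) (Sm p))).
  evar_last; [eapply is_series_ext; [|exact S1]|].
  - intros n; rewrite !qpair_comb; cbn; unfold mult; cbn; real_eq; field.
  - unfold b; rewrite !qpair_comb; cbn; unfold mult; cbn; real_eq; ring. }
assert (Sc : forall p, is_series (fun n => Im ((x, y) ^ n)%C * qpair p (a n)) (qpair p c)).
{ intros p.
  assert (S1 := is_series_scal (/ 2) _ _
    (is_series_minus _ _ _ _ (Sm (qmult p I)) (Sp (qmult p I)))).
  evar_last; [eapply is_series_ext; [|exact S1]|].
  - intros n.
    transitivity (- Im ((x, y) ^ n)%C * qpair (qmult (qmult p I) I) (a n)).
    + rewrite !qpair_comb; cbn; unfold mult; cbn; real_eq; field.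
    + replace (qmult (qmult p I) I) with (qopp p).
      * rewrite !qpair_comb; cbn; ring.
      * transitivity (qmult p (qmult I I)); [rewrite HI|]; apply quat_ext; cbn; ring.
  - unfold c; rewrite !qpair_comb; cbn; unfold mult; cbn; real_eq; ring. }
exists b, c; intros J HJ.
assert (HqJ := in_ball_slice_point r I J x y HI HJ Hq).
split.
- rewrite <- (qseries_unique a _ _ (Ha _ HqJ)).
  apply qseries_unique, is_qseries_slice; [exact HJ|]; intros p.
  evar_last; [apply (is_series_plus _ _ _ _ (Sb p) (Sc (qmult p J)))|].
  rewrite !qpair_comb; cbn; unfold mult; cbn; real_eq; ring.
- apply qseries_unique, is_qseries_slice; [exact HJ|]; intros p; fold a.
  (* The factors [Re ((x, y)^n)] and [Im ((x, y)^n)] are real, so conjugating the coefficients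
     conjugates [b] and [c]; in the pairing the conjugation moves to the functional. *)
  evar_last; [eapply is_series_ext; [|apply (is_series_plus _ _ _ _ (Sb (qconj p))
    (Sc (qconj (qmult p J))))]|].
  + intros n; rewrite !qpair_conj; reflexivity.
  + rewrite !qpair_comb; cbn; unfold mult; cbn; real_eq; ring.
Qed.

(* [|b + I c|^2 = |b|^2 + |c|^2 - 2 <I, Im (c conj b)>], and the vectors
   [Im (c conj b)] and [Im (conj c b)] have the same length, so that a
   reflection [J] of [I] has [<J, Im (conj c b)> = <I, Im (c conj b)>]. *)
Lemma conj_sphere_norm (b c I : quat) :
  imaginary_unit I ->
  exists J, imaginary_unit J /\
    qnorm (qplus b (qmult I c)) = qnorm (qplus (qconj b) (qmult J (qconj c))).
Proof.
intros HI; apply imaginary_unit_spec in HI; destruct HI as [Z N].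
set (v := qmult c (qconj b)); set (w := qmult (qconj c) b).
(* [v] and [w] have the same norm [|b| |c|] and the same real part, the scalar product of [b] and
   [c]. *)
assert (VW : qi v ^ 2 + qj v ^ 2 + qk v ^ 2 = qi w ^ 2 + qj w ^ 2 + qk w ^ 2)
  by (unfold v, w; cbn; ring).
set (d1 := qi v - qi w); set (d2 := qj v - qj w); set (d3 := qk v - qk w).
set (m := d1 ^ 2 + d2 ^ 2 + d3 ^ 2).
assert (EJ : exists J, imaginary_unit J /\
  qi J * qi w + qj J * qj w + qk J * qk w = qi I * qi v + qj I * qj v + qk I * qk v).
{ destruct (Req_dec m 0) as [M|M].
  - exists I; split; [apply imaginary_unit_spec; auto|].
    assert (d1 = 0 /\ d2 = 0 /\ d3 = 0) as (D1 & D2 & D3) by (unfold m in M; nra).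
    unfold d1 in D1; unfold d2 in D2; unfold d3 in D3.
    replace (qi w) with (qi v) by lra; replace (qj w) with (qj v) by lra;
      replace (qk w) with (qk v) by lra; reflexivity.
  (* [J = I - t d] is the mirror image of [I] in the plane orthogonal to [d = Im v - Im w]; as the
     lengths agree, this reflection exchanges [Im v] and [Im w]. *)
  - set (t := 2 * (qi I * d1 + qj I * d2 + qk I * d3) / m).
    exists (Quat 0 (qi I - t * d1) (qj I - t * d2) (qk I - t * d3)); split.
    + apply imaginary_unit_spec; cbn [qre qi qj qk]; split; [reflexivity|].
      transitivity (qi I ^ 2 + qj I ^ 2 + qk I ^ 2
        - t * (2 * (qi I * d1 + qj I * d2 + qk I * d3) - t * m)); [unfold m; ring|].
      rewrite N; unfold t; field; exact M.
    + cbn [qre qi qj qk].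
      assert (W : 2 * (d1 * qi w + d2 * qj w + d3 * qk w) = - m)
        by (unfold m, d1, d2, d3; lra).
      transitivity (qi I * qi w + qj I * qj w + qk I * qk w
        - t * (2 * (d1 * qi w + d2 * qj w + d3 * qk w)) / 2); [field|].
      rewrite W; unfold t.
      transitivity (qi I * qi w + qj I * qj w + qk I * qk w
        + (qi I * d1 + qj I * d2 + qk I * d3)); [field; exact M|].
      unfold d1, d2, d3; ring. }
(* The cross term of the squared norm is [2 Re (J h conj g)], and [Re (J m) = - <J, Im m>] for
   purely imaginary [J]. *)
assert (Nrm : forall g h J : quat, imaginary_unit J ->
  qnorm (qplus g (qmult J h)) = sqrt (qnorm g ^ 2 + qnorm h ^ 2
    - 2 * (qi J * qi (qmult h (qconj g)) + qj J * qj (qmult h (qconj g))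
           + qk J * qk (qmult h (qconj g))))).
{ intros g h J HJ; apply imaginary_unit_spec in HJ; destruct HJ as [ZJ NJ].
  unfold qnorm at 1; f_equal; rewrite !qnorm_sq.
  rewrite <- (Rmult_1_l (qre h ^ 2 + _ + _ + _)), <- NJ.
  cbn; rewrite ZJ; ring. }
destruct EJ as (J & HJ & EJ); exists J; split; [exact HJ|].
rewrite !Nrm by (assumption || (apply imaginary_unit_spec; auto)).
f_equal; fold v.
replace (qmult (qconj c) (qconj (qconj b))) with w
  by (unfold w; apply quat_ext; cbn; ring).
rewrite EJ, !qnorm_sq; cbn; ring.
Qed.

Lemma regular_conj_same_norms (r : R) (f : quat -> quat) (s : R) :
  0 < r -> slice_regular r f ->
  (exists q, in_ball r q /\ s = qnorm (f q)) <->
  (exists q, in_ball r q /\ s = qnorm (regular_conj r f q)).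
Proof.
intros Hr Hf; split; intros (q & Hq & ->);
  destruct (slice_coordinates q) as (I & x & y & HI & ->);
  destruct (sphere_values r f I x y Hr Hf HI Hq) as (b & c & E);
  destruct (E I HI) as [E1 E2]; rewrite ?E1, ?E2.
- destruct (conj_sphere_norm b c I HI) as (J & HJ & EJ).
  exists (slice_point J x y); split; [exact (in_ball_slice_point r I J x y HI HJ Hq)|].
  rewrite (proj2 (E J HJ)); exact EJ.
(* Conjugation is an involution, so the same lemma at [conj b], [conj c] leads back from [f^c] to
   [f]. *)
- destruct (conj_sphere_norm (qconj b) (qconj c) I HI) as (J & HJ & EJ).
  exists (slice_point J x y); split; [exact (in_ball_slice_point r I J x y HI HJ Hq)|].
  rewrite (proj1 (E J HJ)), EJ; f_equal; apply quat_ext; cbn; ring.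
Qed.

Theorem corollary3p3 (r : R) (r_pos : 0 < r) (f : quat -> quat)
    (f_regular : slice_regular r f) :
  sup_ball r f = sup_ball r (regular_conj r f) /\
  inf_ball r f = inf_ball r (regular_conj r f).
Proof.
split; [apply Lub_Rbar_eqset|apply Glb_Rbar_eqset]; intros s;
  apply regular_conj_same_norms; assumption.
Qed.
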